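(* Let $p$ be a prime and let $G$ be a finite group with center $Z(G)$ such that $G/Z(G)\cong\mathbb Z_p\times\mathbb Z_p$; put $n=|Z(G)|$. Then the signless Laplacian spectrum of the non-commuting graph $\Gamma_G$ is $$\left\{(pn(p-1))^{(p^2-1)n-(p+1)},\ \left(n(p-1)^2\right)^p,\ (2pn(p-1))^1\right\}$$ and its signless Laplacian energy is $LE^+(\Gamma_G)=2p(p-1)|Z(G)|$. In particular, if $G$ is non-abelian and $|G|=p^3$, then $LE^+(\Gamma_G)=2p^2(p-1)$.
   Context: For a finite non-abelian group $G$ with center $Z(G)$, the non-commuting graph $\Gamma_G$ is the simple undirected graph with vertex set $G\setminus Z(G)$ in which $x,y$ are adjacent iff $xy\ne yx$. For a finite simple graph $\mathcal G$ with vertex set $v(\mathcal G)$, edge set $e(\mathcal G)$, adjacency matrix $A(\mathcal G)$ and diagonal degree matrix $D(\mathcal G)$, the signless Laplacian matrix is $Q(\mathcal G)=D(\mathcal G)+A(\mathcal G)$, and its signless Laplacian spectrum is the multiset of eigenvalues of $Q(\mathcal G)$. The notation $\{(\gamma_1)^{d_1},\dots,(\gamma_l)^{d_l}\}$ means the multiset in which $\gamma_r$ is listed $d_r$ times. The signless Laplacian energy is $LE^+(\mathcal G)=\sum_{\gamma}\left|\gamma-\frac{2|e(\mathcal G)|}{|v(\mathcal G)|}\right|$, the sum being over the signless Laplacian spectrum with multiplicity. *)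

(* Defs.v *)
From HB Require Import structures.
From mathcomp Require Import all_boot all_order all_algebra.
From mathcomp Require Import all_fingroup all_solvable all_field.

Set Implicit Arguments.
Unset Strict Implicit.
Unset Printing Implicit Defensive.

Import GroupScope Order.TTheory GRing.Theory Num.Theory.
Local Open Scope ring_scope.

Record sgraph := SGraph {
  vertex :> finType;
  adj : rel vertex;
  adj_sym : symmetric adj;
  adj_irr : irreflexive adj
}.

Section Graph.

Variable X : sgraph.

Definition edges : {set {set X}} :=
  [set [set e.1; e.2] | e : X * X & adj e.1 e.2].

Definition degree (x : X) : nat := #|[set y : X | adj x y]|.

(* Rows and columns are indexed by the positions in [enum X]. *)
Definition adjacency_mx : 'M[algC]_#|X| :=
  \matrix_(i, j) (adj (enum_val i) (enum_val j))%:R.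

Definition degree_mx : 'M[algC]_#|X| :=
  diag_mx (\row_i (degree (enum_val i))%:R).

Definition signless_laplacian : 'M[algC]_#|X| := degree_mx + adjacency_mx.

End Graph.

(* The roots of the characteristic polynomial, each repeated according to its
   multiplicity; the order is irrelevant, so compare up to [perm_eq]. *)
Definition spectrum (n : nat) (A : 'M[algC]_n) : seq algC :=
  sval (closed_field_poly_normal (char_poly A)).

Lemma spectrumE (n : nat) (A : 'M[algC]_n) :
  char_poly A = \prod_(z <- spectrum A) ('X - z%:P).
Proof.
rewrite /spectrum; case: closed_field_poly_normal => r /= {1}->.
by rewrite (monicP (char_poly_monic A)) scale1r.
Qed.

Definition signless_spectrum (X : sgraph) : seq algC :=
  spectrum (signless_laplacian X).

Definition signless_energy (X : sgraph) : algC :=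
  \sum_(z <- signless_spectrum X)
    `|z - 2 * #|edges X|%:R / #|X|%:R|.

Section NonCommutingGraph.

Variables (gT : finGroupType) (G : {group gT}).

Definition nc_vertex : finType := {x : gT | x \in G :\: 'Z(G)}.

Definition nc_adj (x y : nc_vertex) : bool :=
  (val x * val y != val y * val x)%g.

Lemma nc_adj_sym : symmetric nc_adj.
Proof. by move=> x y; rewrite /nc_adj eq_sym. Qed.

Lemma nc_adj_irr : irreflexive nc_adj.
Proof. by move=> x; rewrite /nc_adj eqxx. Qed.

Definition noncommuting_graph : sgraph := SGraph nc_adj_sym nc_adj_irr.

End NonCommutingGraph.

(* Main.v *)
(* If |G : Z(G)| = p^2 then the centraliser of a non-central element has index p
   over Z(G), hence is abelian; so commuting is an equivalence relation on
   G \ Z(G) and the non-commuting graph is complete multipartite, with k + 1 = p + 1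
   parts of size m = (p - 1)|Z(G)|. It is regular of degree d = km, so with P the
   vertex-part incidence matrix, x - Q = (x - d) - P (J - I) P^T. As P^T P = m I,
   Sylvester's identity for det (t - U V) and det (t - V U) reduces the
   characteristic polynomial to the determinant of a scalar matrix minus the
   rank one matrix m J, giving the eigenvalues d, d - m, 2d. *)
Require Import Defs.
From HB Require Import structures.
From mathcomp Require Import all_boot all_order all_algebra.
From mathcomp Require Import all_fingroup all_solvable all_field.
From mathcomp Require Import ring.

Set Implicit Arguments.
Unset Strict Implicit.
Unset Printing Implicit Defensive.

Import GroupScope Order.TTheory GRing.Theory Num.Theory.
Local Open Scope ring_scope.

(** * Determinant identities and edge counting *)

(** Multiplying the block matrix [M] by a block triangular matrix on the right (determinant 1) or on
    the left (determinant [t ^+ k]) clears one off-diagonal block. Keeping the powers of [t] avoids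
    dividing by it. *)
Lemma det_scalar_sub_mulmxC (R : comNzRingType) (m k : nat) (t : R)
    (U : 'M[R]_(m, k)) (V : 'M[R]_(k, m)) :
  t ^+ k * \det (t%:M - U *m V) = t ^+ m * \det (t%:M - V *m U).
Proof.
pose M := block_mx t%:M U V (1%:M : 'M[R]_k).
have eqR : M *m block_mx 1%:M 0 (- V) 1%:M = block_mx (t%:M - U *m V) U 0 1%:M.
  by rewrite mulmx_block !mulmx0 !mulmx1 !add0r mulmxN mul1mx addrN.
have eqL : block_mx 1%:M 0 (- V) t%:M *m M = block_mx t%:M U 0 (t%:M - V *m U).
  rewrite mulmx_block !mul0mx !mul1mx !addr0 !mulNmx mulmx1 mul_mx_scalar.
  by rewrite mul_scalar_mx addNr addrC.
have := congr1 determinant eqR; have := congr1 determinant eqL.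
rewrite !det_mulmx !det_lblock !det_ublock !det_scalar !expr1n !mul1r !mulr1.
by move=> <- ->.
Qed.

(** A constant matrix is a column times a row, so the previous identity reduces to a 1 by 1
    determinant. A spare factor [t] is cancelled. *)
Lemma det_scalar_sub_const (R : idomainType) (k : nat) (t a : R) :
  t != 0 ->
  \det (t%:M - const_mx a : 'M[R]_k.+1) = t ^+ k * (t - a *+ k.+1).
Proof.
move=> t0.
have eqUV : const_mx a = (const_mx a : 'cV[R]_k.+1) *m (const_mx 1 : 'rV_k.+1).
  by apply/matrixP=> i j; rewrite !mxE big_ord1 !mxE mulr1.
have := det_scalar_sub_mulmxC t (const_mx a : 'cV[R]_k.+1) (const_mx 1 : 'rV_k.+1).
rewrite -eqUV expr1 exprS -mulrA => /(mulfI t0) ->; congr (_ * _).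
rewrite det_mx11 !mxE eqxx mulr1n; congr (_ - _).
under eq_bigr do rewrite !mxE mul1r.
by rewrite sumr_const card_ord.
Qed.

(** Handshake lemma: the degrees count ordered adjacent pairs, and these are grouped by their
    underlying edge. *)
Lemma sum_degree (X : sgraph) : (\sum_(x : X) degree x = 2 * #|edges X|)%N.
Proof.
have -> : (\sum_(x : X) degree x = \sum_(e in [set e : X * X | adj e.1 e.2]) 1)%N.
  rewrite (eq_bigl (fun e : X * X => xpredT e.1 && adj e.1 e.2)); last first.
    by move=> e; rewrite inE.
  rewrite -(pair_big_dep xpredT (fun x y : X => adj x y) (fun _ _ => 1%N)) /=.
  by apply: eq_bigr => x _; rewrite /degree -sum1dep_card.
rewrite (partition_big_imset (fun e : X * X => [set e.1; e.2])) /=.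
have -> : [set [set e.1; e.2] | e in [set e : X * X | adj e.1 e.2]] = edges X.
  by apply/setP => A; apply/imsetP/imsetP => -[e Ae ->]; exists e;
    move: Ae; rewrite // inE.
rewrite mulnC -sum_nat_const; apply: eq_bigr => A /imsetP[[a b]].
rewrite inE /= => ab ->{A}.
have neq_ab : a != b by apply: contraTneq ab => ->; rewrite adj_irr.
(* The fibre over an edge consists of its two orientations, which differ because there are no
   loops. *)
have /= := cards2 (a, b) (b, a); rewrite xpair_eqE (negbTE neq_ab) /= => <-.
rewrite sum1dep_card; apply: eq_card => -[c d]; rewrite !inE /= !xpair_eqE.
apply/andP/orP => [[cd /eqP eqA] | [] /andP[/eqP-> /eqP->]].
- have : d \in [set a; b] by rewrite -eqA set22.
  have : c \in [set a; b] by rewrite -eqA set21.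
  rewrite !inE => /orP[]/eqP eq_c /orP[]/eqP eq_d.
  + by rewrite eq_c eq_d adj_irr in cd.
  + by left; rewrite eq_c eq_d !eqxx.
  + by right; rewrite eq_c eq_d !eqxx.
  + by rewrite eq_c eq_d adj_irr in cd.
- by [].
- by split; [rewrite adj_sym | rewrite setUC].
Qed.

(** * Complete multipartite graphs with equal parts *)

Section CompleteMultipartite.

Variables (X : sgraph) (T : finType) (f : X -> T) (k m : nat).
Hypothesis adj_f : forall x y : X, adj x y = (f x != f y).
Hypothesis card_part : forall t, #|[set x | f x == t]| = m.

Lemma multipartite_card : #|X| = (#|T| * m)%N.
Proof.
rewrite -sum1_card (partition_big f xpredT) //= -sum_nat_const.
by apply: eq_bigr => t _; rewrite -(card_part t) sum1dep_card.
Qed.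

Hypothesis card_T : #|T| = k.+1.
Hypothesis m_gt0 : (0 < m)%N.

Lemma multipartite_degree (x : X) : degree x = (k * m)%N.
Proof.
have -> : degree x = #|~: [set y | f y == f x]|.
  by apply: eq_card => y; rewrite !inE adj_f eq_sym.
by rewrite cardsCs setCK card_part multipartite_card card_T mulSn addKn.
Qed.

Lemma multipartite_card_edges : (2 * #|edges X| = #|X| * (k * m))%N.
Proof.
rewrite -sum_degree -sum_nat_const; apply: eq_bigr => x _.
exact: multipartite_degree.
Qed.

Let P : 'M[{poly algC}]_(#|X|, #|T|) :=
  \matrix_(i, j) (f (enum_val i) == enum_val j)%:R.

Lemma multipartite_char_poly :
  char_poly (signless_laplacian X) =
    ('X - (k * m)%:R%:P) ^+ (#|X| - k.+1) * ('X - ((k * m)%:R - m%:R)%:P) ^+ k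
    * ('X - (2 * (k * m)%:R)%:P).
Proof.
set d : algC := (k * m)%:R; set t : {poly algC} := 'X - d%:P.
have tP : t != 0 by rewrite polyXsubC_eq0.
(* [K] is the adjacency matrix of the complete graph on the parts. *)
pose K : 'M[{poly algC}]_#|T| := const_mx 1 - 1%:M.
have PTP : P^T *m P = m%:R%:M.
  apply/matrixP => i j; rewrite !mxE.
  under eq_bigr => x _ do rewrite !mxE -natrM mulnb.
  rewrite -natr_sum; case: eqVneq => [<-|ne_ij] /=; last first.
    rewrite big1 // => x _; case: eqP => //= ->.
    by rewrite (inj_eq enum_val_inj) (negbTE ne_ij).
  congr _%:R; rewrite -(card_part (enum_val i)) -sum1dep_card.
  rewrite (reindex (enum_val : 'I_#|X| -> X)) /=; last first.
    by exists enum_rank => x _; [exact: enum_valK | exact: enum_rankK].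
  by rewrite [RHS]big_mkcond; apply: eq_bigr => x _; rewrite andbb; case: (_ == _).
have PKP : char_poly_mx (signless_laplacian X) = t%:M - P *m (K *m P^T).
  apply/matrixP => i j; rewrite !mxE multipartite_degree adj_f.
  (* Each row of [P] has a single 1, in the column of the part of that vertex, so both sums collapse
     to one term. *)
  have -> : \sum_l P i l * (K *m P^T) l j = (f (enum_val i) != f (enum_val j))%:R.
    rewrite (bigD1 (enum_rank (f (enum_val i)))) //= mxE enum_rankK eqxx mul1r.
    rewrite big1 ?addr0 => [|l]; last first.
      by rewrite mxE -(inj_eq enum_val_inj) enum_rankK eq_sym => /negbTE ->; rewrite mul0r.
    rewrite mxE (bigD1 (enum_rank (f (enum_val j)))) //= !mxE enum_rankK eqxx mulr1.
    rewrite big1 ?addr0 => [|l]; last first.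
      by rewrite !mxE -(inj_eq enum_val_inj) enum_rankK eq_sym => /negbTE ->; rewrite mulr0.
    rewrite (inj_eq enum_rank_inj).
    by case: eqP => _ /=; rewrite ?subrr ?subr0.
  rewrite rmorphD /= rmorph_nat opprD addrA; congr (_ - _).
  by case: (i == j); rewrite ?mulr1n // !mulr0n polyC0 subr0.
have := det_scalar_sub_mulmxC t P (K *m P^T).
rewrite -PKP -/(char_poly _) -mulmxA PTP mul_mx_scalar.
have -> : t%:M - m%:R *: K = (t + m%:R)%:M - const_mx m%:R.
  by apply/matrixP => i j; rewrite !mxE; case: (i == j); rewrite /= ?mulr1n ?mulr0n; ring.
rewrite card_T det_scalar_sub_const; last first.
  rewrite /t -[m%:R]opprK -(rmorph_nat (@polyC algC)) -addrA -opprD -rmorphB /=.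
  by rewrite polyXsubC_eq0.
(* This makes the truncated subtraction exact, so that [t ^+ k.+1] can be cancelled from both
   sides. *)
have leNk : (k.+1 <= #|X|)%N by rewrite multipartite_card card_T leq_pmulr.
rewrite -[X in t ^+ X * (_ * _)](subnKC leNk) exprD -mulrA => /(mulfI (expf_neq0 _ tP)) ->.
rewrite -mulrA; congr (_ * (_ ^+ _ * _)).
  by rewrite /t rmorphB /= rmorph_nat; ring.
(* The last factor is [t + m - m(k + 1) = t - km = 'X - 2d]. *)
by rewrite /t /d polyCM !polyC_natr -[m%:R *+ _]mulr_natr natrM -(natr1 k); ring.
Qed.

Lemma multipartite_signless_spectrum :
  perm_eq (signless_spectrum X)
    (nseq (#|X| - k.+1) (k * m)%:R ++ nseq k ((k * m)%:R - m%:R)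
     ++ nseq 1 (2 * (k * m)%:R)).
Proof.
apply: prod_XsubC_eq; rewrite -spectrumE multipartite_char_poly.
by rewrite !big_cat !big_nseq !iter_mulr_1 -mulrA.
Qed.

(** By regularity the mean degree is [km]. The deviations from it are 0, then [-m] taken [k] times,
    then [km] once. *)
Lemma multipartite_signless_energy : signless_energy X = (2 * (k * m))%:R.
Proof.
have X_neq0 : #|X|%:R != 0 :> algC.
  by rewrite pnatr_eq0 multipartite_card card_T -lt0n muln_gt0.
have average_degree : 2 * #|edges X|%:R / #|X|%:R = (k * m)%:R :> algC.
  by rewrite -natrM multipartite_card_edges natrM mulrAC mulfV // mul1r.
rewrite /signless_energy average_degree (perm_big _ multipartite_signless_spectrum).
rewrite !big_cat !big_nseq !iter_addr_0 subrr normr0 mul0rn.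
have -> : (k * m)%:R - m%:R - (k * m)%:R = - m%:R :> algC by ring.
have -> : 2 * (k * m)%:R - (k * m)%:R = (k * m)%:R :> algC by ring.
rewrite normrN !normr_nat [LHS]add0r -!mulrnA muln1 mulnC.
by rewrite mul2n -addnn natrD.
Qed.

End CompleteMultipartite.

(** * Centralisers when the centre has index [p ^ 2] *)

Section CentralQuotientOfOrderP2.

Variables (gT : finGroupType) (G : {group gT}) (p : nat).
Hypothesis p_prime : prime p.
Hypothesis index_center : #|G : 'Z(G)|%g = (p ^ 2)%N.

Lemma center_sub_subcent1 (x : gT) : x \in G -> 'Z(G)%g \subset 'C_G[x]%g.
Proof.
move=> Gx; rewrite subsetI center_sub sub_cent1.
by apply: subsetP Gx; rewrite centsC subsetIr.
Qed.

(** The index divides [p ^ 2]. Index [p ^ 2] would make [x] central, and index 1 would put [x],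
    which lies in its own centraliser, in the centre. *)
Lemma index_center_subcent1 (x : gT) :
  x \in G :\: 'Z(G)%g -> #|'C_G[x] : 'Z(G)|%g = p.
Proof.
case/setDP => Gx notZx.
have sZC := center_sub_subcent1 Gx; have sCG : 'C_G[x]%g \subset G := subsetIl _ _.
have Cx : x \in 'C_G[x]%g by rewrite inE Gx cent1id.
have := Lagrange_index sCG sZC; rewrite index_center => eq_p2.
have : (#|'C_G[x] : 'Z(G)|%g %| p ^ 2)%N by rewrite -eq_p2 dvdn_mull.
case/(dvdn_pfactor _ _ p_prime) => -[|[|[|//]]] _ eq_e; last 1 first.
- case/negP: notZx; rewrite inE Gx -sub_cent1.
  have /eqP : (#|G : 'C_G[x]| * p ^ 2 = 1 * p ^ 2)%N by rewrite -{1}eq_e eq_p2 mul1n.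
  by rewrite eqn_pmul2r ?expn_gt0 ?prime_gt0 // indexg_eq1 => /subset_trans->; rewrite ?subsetIr.
- case/negP: notZx; move/eqP: eq_e; rewrite expn0 indexg_eq1.
  by move/subsetP; apply.
- exact: eq_e.
Qed.

Lemma card_subcent1 (x : gT) :
  x \in G :\: 'Z(G)%g -> #|'C_G[x]%g| = (p * #|'Z(G)%g|)%N.
Proof.
move=> nZx; rewrite -(index_center_subcent1 nZx) mulnC Lagrange //.
by case/setDP: nZx => Gx _; apply: center_sub_subcent1.
Qed.

(** The quotient by the central subgroup ['Z(G)] has prime order, hence is cyclic. *)
Lemma abelian_subcent1 (x : gT) : x \in G :\: 'Z(G)%g -> abelian 'C_G[x]%g.
Proof.
move=> nZx; have Gx : x \in G by case/setDP: nZx.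
have sZC := center_sub_subcent1 Gx.
have sZZC : 'Z(G)%g \subset 'Z('C_G[x])%g.
  by rewrite subsetI sZC (subset_trans (subsetIr G _)) // centS // subsetIl.
apply: (cyclic_factor_abelian sZZC); apply: prime_cyclic.
rewrite card_quotient ?index_center_subcent1 //.
exact: normal_norm (sub_center_normal sZZC).
Qed.

(** If [y] commutes with [x], it lies in the abelian group ['C_G[x]], so ['C_G[x]] is contained in
    ['C_G[y]]; the orders agree. *)
Lemma subcent1_eq (x y : gT) : x \in G :\: 'Z(G)%g -> y \in G :\: 'Z(G)%g ->
  ('C_G[x] == 'C_G[y])%g = (x * y == y * x)%g.
Proof.
move=> nZx nZy; have Gx : x \in G by case/setDP: nZx.
have Gy : y \in G by case/setDP: nZy.
rewrite -cent1E; apply/eqP/idP => [eqC | xCy].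
  by have : x \in 'C_G[x]%g by [rewrite inE Gx cent1id]; rewrite eqC => /setIP[].
apply/eqP; rewrite eqEcard !card_subcent1 // leqnn andbT subsetI subsetIl.
rewrite sub_cent1; apply: (subsetP (abelian_subcent1 nZx)).
by rewrite inE Gy cent1C.
Qed.

(** The centralisers themselves label the parts. *)
Let part := {A : {set gT} | A \in [set 'C_G[x]%g | x in G :\: 'Z(G)%g]}.

Let part_of (x : noncommuting_graph G) : part :=
  exist _ 'C_G[val x]%g (imset_f (fun x => 'C_G[x]%g) (valP x)).

Lemma nc_adjE (x y : noncommuting_graph G) : adj x y = (part_of x != part_of y).
Proof.
by rewrite -val_eqE /= (subcent1_eq (valP x) (valP y)).
Qed.

Lemma card_nc_part (A : part) :
  #|[set x | part_of x == A]| = ((p - 1) * #|'Z(G)%g|)%N.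
Proof.
case: A => A A_part; have /imsetP[x nZx eqA] := A_part.
have [Gx _] := setDP nZx.
rewrite -(card_imset _ val_inj).
(* The part labelled ['C_G[x]] is ['C_G[x]] minus the centre. *)
have <- : #|'C_G[x] :\: 'Z(G)|%g = ((p - 1) * #|'Z(G)%g|)%N.
  rewrite cardsD (setIidPr (center_sub_subcent1 Gx)).
  by rewrite card_subcent1 // mulnBl mul1n.
apply: eq_card => y.
apply/imsetP/setDP => [[z]|[]].
  rewrite inE -val_eqE /= eqA => /eqP eqC ->; have := valP z; case/setDP => Gz nZz.
  by split=> //; rewrite -eqC inE Gz cent1id.
move=> /setIP[Gy xCy] nZy; have nZGy : y \in G :\: 'Z(G)%g by apply/setDP.
exists (exist _ y nZGy) => //; rewrite inE -val_eqE /= eqA subcent1_eq //.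
by rewrite -cent1E.
Qed.

Let m_gt0 : (0 < (p - 1) * #|'Z(G)%g|)%N.
Proof. by rewrite muln_gt0 subn_gt0 prime_gt1 ?cardG_gt0. Qed.

Lemma card_nc_vertex : #|noncommuting_graph G| = ((p ^ 2 - 1) * #|'Z(G)%g|)%N.
Proof.
rewrite card_sig mulnBl mul1n -index_center mulnC (Lagrange (center_sub G)).
by rewrite -{2}(setIidPr (center_sub G)) -cardsD.
Qed.

(** Counting vertices by parts and dividing by the part size gives the number of parts, as
    [p ^ 2 - 1 = (p - 1)(p + 1)]. *)
Let card_parts : #|{: part}| = p.+1.
Proof.
apply/eqP; rewrite -(eqn_pmul2r m_gt0) -(multipartite_card card_nc_part).
by rewrite card_nc_vertex mulnA -[p.+1]addn1 [((p + 1) * _)%N]mulnC -subn_sqr.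
Qed.

Lemma nc_signless_spectrum :
  perm_eq (signless_spectrum (noncommuting_graph G))
    (nseq ((p ^ 2 - 1) * #|'Z(G)%g| - (p + 1))%N
       (p%:R * #|'Z(G)%g|%:R * (p%:R - 1))
     ++ nseq p (#|'Z(G)%g|%:R * (p%:R - 1) ^+ 2)
     ++ nseq 1 (2 * p%:R * #|'Z(G)%g|%:R * (p%:R - 1))).
Proof.
have := multipartite_signless_spectrum nc_adjE card_nc_part card_parts m_gt0.
rewrite card_nc_vertex addn1 !natrM natrB ?prime_gt0 //.
congr (perm_eq _ (nseq _ _ ++ nseq _ _ ++ nseq _ _)); ring.
Qed.

Lemma nc_signless_energy :
  signless_energy (noncommuting_graph G) = 2 * p%:R * (p%:R - 1) * #|'Z(G)%g|%:R.
Proof.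
rewrite (multipartite_signless_energy nc_adjE card_nc_part card_parts m_gt0).
by rewrite !natrM natrB ?prime_gt0 // !mulrA.
Qed.

End CentralQuotientOfOrderP2.

(** * Groups of order [p ^ 3] and the final statement *)

(** Such a group is extraspecial, so its centre has order [p]. *)
Lemma index_center_p3group (gT : finGroupType) (G : {group gT}) (p : nat) :
  prime p -> ~~ abelian G -> #|G| = (p ^ 3)%N ->
  #|'Z(G)%g| = p /\ #|G : 'Z(G)|%g = (p ^ 2)%N.
Proof.
move=> p_prime nabG oG.
have pG : p.-group%g G by rewrite /pgroup oG pnatX pnat_id.
have esG : extraspecial G by apply: (p3group_extraspecial pG nabG); rewrite oG pfactorK.
have oZ := card_center_extraspecial pG esG; split=> //.
by rewrite -divgS ?center_sub // oG oZ expnS mulKn ?prime_gt0.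
Qed.

Theorem theorem3p2 (p : nat) (p_prime : prime p) :
  (forall (gT : finGroupType) (G : {group gT}) (n : nat),
     (G / 'Z(G))%g \isog [set: 'Z_p * 'Z_p] ->
     n = #|'Z(G)%g| ->
     perm_eq (signless_spectrum (noncommuting_graph G))
       (nseq ((p ^ 2 - 1) * n - (p + 1))%N (p%:R * n%:R * (p%:R - 1))
        ++ nseq p (n%:R * (p%:R - 1) ^+ 2)
        ++ nseq 1 (2 * p%:R * n%:R * (p%:R - 1)))
     /\ signless_energy (noncommuting_graph G)
        = 2 * p%:R * (p%:R - 1) * #|'Z(G)%g|%:R)
  /\
  (forall (gT : finGroupType) (G : {group gT}),
     ~~ abelian G -> #|G| = (p ^ 3)%N ->
     signless_energy (noncommuting_graph G) = 2 * p%:R ^+ 2 * (p%:R - 1)).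
Proof.
split=> [gT G n isoG -> | gT G nabG oG].
  have iZ : #|G : 'Z(G)|%g = (p ^ 2)%N.
    rewrite -card_quotient ?normal_norm ?center_normal // (card_isog isoG).
    (* ['Z_p] has [p] elements only when [p > 1], which primality ensures. *)
    by rewrite cardsT card_prod card_ord Zp_cast ?prime_gt1.
  by split; [exact: nc_signless_spectrum | exact: nc_signless_energy].
have [oZ iZ] := index_center_p3group p_prime nabG oG.
by rewrite (nc_signless_energy p_prime iZ) oZ; ring.
Qed.
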